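(* Let $m\ge1$ be an integer, $0<\rho<1$, $0<p<1$, and let $\mu$ be the Bernoulli convolution or Cantor measure with contraction factor $\rho$ and probabilities $p,\,1-p$. Suppose that either (i) $p\neq 1-p$ (the biased case) and $\rho>\frac{1}{m+1}$, or (ii) $p=1-p=\frac12$ (the unbiased case) and $\rho>\frac{\sqrt{m^2+4}-m}{2}$. Then the $m$-fold convolution of $\mu$ with itself has an isolated point in its set of local dimensions.
   Context: The Bernoulli convolution or Cantor measure with contraction factor $\rho$ and probabilities $p_0,p_1>0$, $p_0+p_1=1$, is the unique Borel probability measure $\mu$ on $[0,1]$ satisfying $\mu=p_0\cdot\mu\circ S_0^{-1}+p_1\cdot\mu\circ S_1^{-1}$, where $S_0(x)=\rho x$ and $S_1(x)=\rho x+1-\rho$. The $m$-fold convolution is defined inductively by $\mu^1=\mu$ and $\mu^m=\mu^{m-1}*\mu$; it may be rescaled by the map $x\mapsto x/m$ to have support in $[0,1]$, which does not affect local dimensions. For a measure $\nu$ and $x\in\operatorname{supp}\nu$, the local dimension is $\dim_{\mathrm{loc}}\nu(x)=\lim_{\epsilon\to0^+}\frac{\log\nu([x-\epsilon,x+\epsilon])}{\log\epsilon}$ when the limit exists. The set of local dimensions of $\nu$ is the set of values $\dim_{\mathrm{loc}}\nu(x)$ over those $x\in\operatorname{supp}\nu$ where the limit exists. *)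

(* Defs.v *)
From HB Require Import structures.
From mathcomp Require Import all_boot all_order all_algebra.
From mathcomp Require Import all_classical all_reals all_analysis.
From mathcomp Require Import measurable_realfun.

Set Implicit Arguments.
Unset Strict Implicit.
Unset Printing Implicit Defensive.
Import Order.TTheory GRing.Theory Num.Theory.
Import numFieldNormedType.Exports.

Local Open Scope classical_set_scope.
Local Open Scope ring_scope.

Definition S0 (R : realType) (rho x : R) : R := rho * x.
Definition S1 (R : realType) (rho x : R) : R := rho * x + 1 - rho.

(* A measure on [0, 1] is represented as a measure on the real line giving
   full mass to `[0, 1]. The equation determines such a mu uniquely when
   0 < rho < 1, p0 > 0, p1 > 0 and p0 + p1 = 1. *)
Definition is_bernoulli_convolution (R : realType) (rho p0 p1 : R)
    (mu : probability (measurableTypeR R) R) : Prop :=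
  mu `[0, 1]%classic = 1%E /\
  forall A : set (measurableTypeR R), measurable A ->
    mu A = (p0%:E * mu (S0 rho @^-1` A) +
            p1%:E * mu (S1 rho @^-1` A))%E.

Section convolution.
Context {R : realType}.
Local Notation RB := (measurableTypeR R).

Definition add_pair (z : RB * RB) : RB := z.1 + z.2.

Let measurable_add_pair : measurable_fun [set: RB * RB] add_pair.
Proof. by apply: measurable_funD; [exact: measurable_fst|exact: measurable_snd]. Qed.

HB.instance Definition _ :=
  isMeasurableFun.Build _ _ _ _ add_pair measurable_add_pair.

Definition convolution (mu nu : probability RB R) : probability RB R :=
  distribution (mu \x nu)%E add_pair.

(* The value at m = 0 is the neutral element; it plays no role for m >= 1. *)
Fixpoint convolution_power (mu : probability RB R) (m : nat)
    : probability RB R :=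
  match m with
  | 0%N => \d_(0 : RB)
  | 1%N => mu
  | m'.+1 => convolution (convolution_power mu m') mu
  end.

Definition msupport (nu : probability RB R) : set R :=
  [set x | forall U : set R, open U -> U x -> (0 < nu U)%E].

Definition has_local_dimension (nu : probability RB R) (x d : R) : Prop :=
  ln (fine (nu `[x - e, x + e]%classic)) / ln e @[e --> (0 : R)^'+] --> d.

Definition local_dimensions (nu : probability RB R) : set R :=
  [set d | exists2 x, msupport nu x & has_local_dimension nu x d].

End convolution.

(* Main.v *)
Require Import Defs.
From HB Require Import structures.
From mathcomp Require Import all_boot all_order all_algebra.
From mathcomp Require Import all_classical all_reals all_analysis.
From mathcomp Require Import measurable_realfun.
From mathcomp Require Import ring lra.
Import Order.TTheory GRing.Theory Num.Theory.
Import numFieldNormedType.Exports.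

Set Implicit Arguments.
Unset Strict Implicit.
Unset Printing Implicit Defensive.

Local Open Scope classical_set_scope.
Local Open Scope ring_scope.

(* The m-fold convolution nu is the self-similar measure on [0, m] of the maps
   T_j x = rho x + (1 - rho) j, 0 <= j <= m, with binomial weights
   w_j = C(m, j) p^(m-j) (1-p)^j.  Near 0 only T_0 contributes, so the local
   dimension at 0 is log w_0 / log rho, and by symmetry that at m is
   log w_m / log rho.  Assume p <= 1 - p, so that w_0 is the smallest weight.
   Any other point x is followed backwards along T_j^-1, choosing digits j that
   keep the orbit in a fixed interval.  Since the images of the T_j overlap, a
   window [A, t] is visited once in every block of N steps, and there the mass
   bound improves on w_0 by a factor K > 1: in the biased case a digit j > 0 can
   be used; in the unbiased case either a digit 0 < j < m can be used, or (for
   m = 1) both digits can be used simultaneously.  The condition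
   rho^2 + m rho > 1 says that multiplication by 1/rho cannot jump over the
   window [A, m - A].  Hence nu(B(x, m rho^(N k))) >= C (K w_0^N)^k, and all
   other local dimensions are at most log w_0 / log rho - c with a uniform
   c > 0. *)

(* The properties of [f x r = nu [x - r, x + r]] on which the argument rests; in
   this form the reflection [x |-> m - x] exchanges the two endpoints. *)
Record cantor_profile (R : realFieldType) (m : nat) (rho : R)
    (w : nat -> R) (f : R -> R -> R) : Prop := CantorProfile {
  profile_le : forall x r s, r <= s -> f x r <= f x s ;
  profile_full : forall x r, 0 <= x <= m%:R -> m%:R <= r -> f x r = 1 ;
  profile_null : forall x r, x + r < 0 \/ m%:R < x - r -> f x r = 0 ;
  profile_ge0 : forall x r, 0 <= f x r ;
  profile_split : forall x r, f x r =
    \sum_(j < m.+1) w j * f ((x - (1 - rho) * j%:R) / rho) (r / rho) }.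

(** * Inverse branches acting on a profile of ball masses *)

Section Profile.
Context {R : realFieldType} (m : nat) (rho : R) (w : nat -> R).
Context (f : R -> R -> R).
Hypothesis rho01 : 0 < rho < 1.
Hypothesis w_gt0 : forall j, (j <= m)%N -> 0 < w j.
Hypothesis Hf : cantor_profile m rho w f.

Let rho_gt0 : 0 < rho. Proof. by case/andP: rho01. Qed.
Let rho_lt1 : rho < 1. Proof. by case/andP: rho01. Qed.

Definition preimage_digit (x : R) (j : nat) : R := (x - (1 - rho) * j%:R) / rho.

Lemma preimage_digit_bounds a b x j :
  (a <= preimage_digit x j <= b) = (rho * a <= x - (1 - rho) * j%:R <= rho * b).
Proof.
by rewrite /preimage_digit ler_pdivlMr // ler_pdivrMr // ![_ * rho]mulrC.
Qed.

Lemma preimage_digit0 x : preimage_digit x 0 = x / rho.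
Proof. by rewrite /preimage_digit mulr0 subr0. Qed.

Let term_ge0 x r (j : 'I_m.+1) :
  0 <= w j * f ((x - (1 - rho) * j%:R) / rho) (r / rho).
Proof. by rewrite mulr_ge0 ?(profile_ge0 Hf) // ltW // w_gt0 // -ltnS. Qed.

Lemma profile_ge_digit x r j : (j <= m)%N ->
  w j * f (preimage_digit x j) (r / rho) <= f x r.
Proof.
move=> jm; rewrite (profile_split Hf x r).
by rewrite (bigD1 (Ordinal (jm : j < m.+1)%N)) //= lerDl sumr_ge0.
Qed.

Lemma profile_ge_two_digits x r i j : (i < j <= m)%N ->
  w i * f (preimage_digit x i) (r / rho) +
  w j * f (preimage_digit x j) (r / rho) <= f x r.
Proof.
case/andP=> ij jm; rewrite (profile_split Hf x r).
have im : (i < m.+1)%N by rewrite ltnS (leq_trans (ltnW ij)).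
rewrite (bigD1 (Ordinal (jm : j < m.+1)%N)) //= addrC lerD //.
rewrite (bigD1 (Ordinal im)) /=; last by rewrite -val_eqE /= neq_ltn ij.
by rewrite lerDl sumr_ge0.
Qed.

(** The map [x |-> m - x] conjugates [T_j] to [T_(m-j)], so the weights are reversed. *)
Lemma reflect_profile :
  cantor_profile m rho (fun j => w (m - j)%N) (fun x => f (m%:R - x)).
Proof.
split=> [x r s|x r /andP[x0 xm]|x r xr|x r|x r].
- exact: profile_le Hf _ _ _.
- by apply: (profile_full Hf); lra.
- by apply: (profile_null Hf); case: xr => xr; [right|left]; lra.
- exact: profile_ge0 Hf _ _.
rewrite (profile_split Hf) (reindex_inj rev_ord_inj) /=.
apply: eq_bigr => j _; have jm : (j <= m)%N by rewrite -ltnS.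
rewrite subSS natrB //; congr (_ * f _ _); field.
by rewrite gt_eqF.
Qed.

(** Asking for the bound [h] on the whole of [[a, b]] spares tracking where the orbit lands, so that
    gains compose. *)
Definition gains (a b x : R) (k : nat) (c : R) : Prop :=
  forall r h, 0 <= h -> (forall y, a <= y <= b -> h <= f y r) ->
    c * h <= f x (r * rho ^+ k).

Lemma gains_le a b x k c c' : c' <= c -> gains a b x k c -> gains a b x k c'.
Proof. by move=> cc g r h h0 /(g r h h0); apply: le_trans; rewrite ler_wpM2r. Qed.

Lemma gains_trans a b x k c l d : 0 <= d ->
  gains a b x k c -> (forall y, a <= y <= b -> gains a b y l d) ->
  gains a b x (k + l) (c * d).
Proof.
move=> d0 gx gy r h h0 hr; rewrite addnC exprD mulrA -mulrA.
by apply: gx => [|y yI]; [rewrite mulr_ge0|apply: gy].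
Qed.

Lemma gains_after a b x j k c : (j <= m)%N ->
  gains a b (preimage_digit x j) k c -> gains a b x k.+1 (w j * c).
Proof.
move=> jm g r h h0 hr; apply: le_trans (profile_ge_digit x _ jm).
rewrite exprSr mulrA mulfK ?gt_eqF // -mulrA ler_wpM2l ?g //.
by rewrite ltW // w_gt0.
Qed.

Lemma gains_digit a b x j : (j <= m)%N ->
  a <= preimage_digit x j <= b -> gains a b x 1 (w j).
Proof.
move=> jm xj; rewrite -[w j]mulr1; apply: gains_after => // r h h0 /(_ _ xj).
by rewrite mul1r expr0 mulr1.
Qed.

(** Distinct branches are separate terms of one sum, so their weights add. This provides the growth
    in the unbiased case with [m = 1]. *)
Lemma gains_two_digits a b x i j : (i < j <= m)%N ->
  a <= preimage_digit x i <= b -> a <= preimage_digit x j <= b ->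
  gains a b x 1 (w i + w j).
Proof.
move=> ijm xi xj r h h0 hr; apply: le_trans (profile_ge_two_digits x _ ijm).
case/andP: ijm => ij jm; rewrite expr1 mulfK ?gt_eqF // mulrDl.
by rewrite lerD // ler_wpM2l ?hr // ltW // w_gt0 // (leq_trans (ltnW ij)).
Qed.

Lemma gains_iter a b x N c : (forall y, a <= y <= b -> gains a b y N c) ->
  0 <= a -> b <= m%:R -> 0 <= c ->
  a <= x <= b -> forall k, c ^+ k <= f x (m%:R * rho ^+ (N * k)).
Proof.
move=> g a0 bm c0 xI k; elim: k x xI => [|k IH] x xI.
  rewrite muln0 expr0 mulr1 (profile_full Hf) //; lra.
rewrite exprS mulnSr exprD mulrA; apply: g => //; exact: exprn_ge0.
Qed.

(** Consecutive translates of [[a, b]] by [t] leave no gap between them. *)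
Lemma exists_digit (n : nat) (a b t y : R) : t <= b - a -> a <= y ->
  y <= b + t * n%:R -> exists2 j, (j <= n)%N & a <= y - t * j%:R <= b.
Proof.
move=> tab ay; elim: n => [|n IH] yb.
  by exists 0%N => //; move: yb; rewrite mulr0; lra.
have [/IH[j jn yj]|yb'] := lerP y (b + t * n%:R).
  by exists j => //; rewrite ltnW.
by exists n.+1 => //; move: yb; rewrite -natr1; lra.
Qed.

(* Below [A] the digit [0] multiplies the point by [rho^-1], and [A <= rho * t]
   prevents the orbit from jumping over the window [A, t], where a factor [K]
   is gained. *)
Lemma gains_climb a b t A K : 0 <= a -> 0 <= K ->
  A <= rho * t -> A <= rho * b ->
  (forall y, a <= y <= b -> gains a b y 1 (w 0)) ->
  (forall y, a <= y <= b -> A <= y <= t -> gains a b y 1 (K * w 0)) ->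
  forall n x, a <= x <= b -> x <= t -> A * rho ^+ n <= x ->
    gains a b x n.+1 (K * w 0 ^+ n.+1).
Proof.
move=> a0 K0 At Ab step bonus.
have w0 : 0 < w 0 by apply: w_gt0.
(* Once the factor [K] is collected, the rest of the block is spent at the plain rate [w 0], so
   every point uses exactly [n.+1] digits. *)
have pad n y : a <= y <= b -> gains a b y n (w 0 ^+ n).
  elim: n y => [|n IH] y yI; last by rewrite exprS -add1n; apply: gains_trans;
    rewrite ?exprn_ge0 ?(ltW w0) //; exact: step.
  by move=> r h _ /(_ _ yI); rewrite !expr0 mulr1 mul1r.
elim=> [|n IH] x xI xt Ax.
  by rewrite expr1; apply: bonus => //; rewrite mulr1 in Ax; rewrite Ax.
have [Ax'|xA] := lerP A x.
  rewrite exprS mulrA -add1n; apply: gains_trans => [||y yI].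
  - by rewrite exprn_ge0 ?ltW.
  - by apply: bonus => //; rewrite Ax'.
  - exact: pad.
rewrite exprS mulrCA; apply: gains_after => //.
have xr : a <= x / rho.
  case/andP: xI => ax _.
  by rewrite ler_pdivlMr // (le_trans _ ax) // ler_piMr // ltW.
(* As [x < A], the bounds on [A] keep [x / rho] below both [b] and [t]. *)
rewrite preimage_digit0; apply: IH.
- by rewrite xr ler_pdivrMr // [b * _]mulrC; lra.
- by rewrite ler_pdivrMr // [t * _]mulrC; lra.
- by rewrite ler_pdivlMr // -mulrA -exprSr.
Qed.

(** The digit 0 pushes a small point up into [[a, b]], and [a <= rho * b] prevents overshooting. The
    number of steps depends on [x] but not on [k], so only [C] is affected. *)
Lemma reach_interval a b N c : 0 < a -> a <= rho * b ->
  (forall x, a <= x <= b -> forall k, c ^+ k <= f x (m%:R * rho ^+ (N * k))) ->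
  forall n x, 0 < x <= b -> a * rho ^+ n <= x ->
    exists2 C, 0 < C & forall k, C * c ^+ k <= f x (m%:R * rho ^+ (N * k)).
Proof.
move=> a0 ab H; have w0 : 0 < w 0 by apply: w_gt0.
elim=> [|n IH] x /andP[x0 xb] ax.
  by exists 1 => // k; rewrite mul1r H // -[a]mulr1 ax.
have [a_x|x_a] := lerP a x; first by exists 1 => // k; rewrite mul1r H // a_x.
have [||C C0 HC] := IH (x / rho).
- by rewrite divr_gt0 // ler_pdivrMr // [b * _]mulrC; lra.
- by rewrite ler_pdivlMr // -mulrA -exprSr.
exists (w 0 * C) => [|k]; first exact: mulr_gt0.
apply: le_trans (profile_ge_digit x _ (leq0n m)); rewrite preimage_digit0 -mulrA.
(* The step enlarges the radius by [rho^-1]; monotonicity allows the same [k] to be kept. *)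
rewrite ler_wpM2l ?(ltW w0) // (le_trans (HC k)) // (profile_le Hf) //.
by rewrite ler_pdivlMr // ler_piMr ?(ltW rho_lt1) // mulr_ge0 // exprn_ge0 ?ltW.
Qed.

End Profile.

(** * Uniform growth in the biased and unbiased cases *)

Lemma expr_lt_eventually (R : realType) (z e : R) : 0 < z < 1 -> 0 < e ->
  exists k0, forall k, (k0 <= k)%N -> z ^+ k < e.
Proof.
case/andP=> z0 z1 e0; have : `|z| < 1 by rewrite gtr0_norm.
by move=> /cvg_expr /cvgr_lt /(_ e e0) [k0 _ H]; exists k0 => k; apply: H.
Qed.

(** Only [C] may depend on [x]: common [N] and [K] make the resulting gap in dimension uniform. *)
Definition uniform_growth (R : realType) (m : nat) (rho w0 : R)
    (D : set R) (f : R -> R -> R) : Prop :=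
  exists N K, [/\ (0 < N)%N, 1 < K & forall x, D x ->
    exists2 C, 0 < C &
      forall k, C * (K * w0 ^+ N) ^+ k <= f x (m%:R * rho ^+ (N * k))].

Section Growth.
Context {R : realType} (m : nat) (rho : R).
Hypothesis rho01 : 0 < rho < 1.

Let rho_gt0 : 0 < rho. Proof. by case/andP: rho01. Qed.
Let rho_lt1 : rho < 1. Proof. by case/andP: rho01. Qed.

Lemma climb_length (a A : R) : 0 < a -> 0 < A ->
  exists n, A * rho ^+ n <= a.
Proof.
move=> a0 A0; have [n Hn] := expr_lt_eventually rho01 (divr_gt0 a0 A0).
exists n; rewrite mulrC -ler_pdivlMr //; exact: ltW (Hn _ (leqnn n)).
Qed.

Lemma biased_growth (w : nat -> R) f K :
  (forall j, (j <= m)%N -> 0 < w j) -> cantor_profile m rho w f ->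
  1 < K -> (forall j, (0 < j <= m)%N -> K * w 0 <= w j) ->
  1 - rho < rho * m%:R ->
  uniform_growth m rho (w 0) [set x | 0 < x <= m%:R] f.
Proof.
move=> w_gt0 Hf K1 Kw hm; have w0 : 0 < w 0 by apply: w_gt0.
have m0 : (0 < m)%N.
  by rewrite lt0n; apply: contraTneq hm => ->; rewrite mulr0 -leNgt subr_ge0 ltW.
(* The strict inequality [hm] leaves room for [a > 0] such that the images of [[a, m]] under
   neighbouring maps still meet. *)
have [a [a0 a1 am]] : exists a, [/\ 0 < a, a <= 1 & rho * a <= rho * m%:R - (1 - rho)].
  exists (Num.min 1 ((rho * m%:R - (1 - rho)) / rho)); split.
  - by rewrite lt_min ltr01 divr_gt0 // subr_gt0.
  - by rewrite ge_min lexx.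
  - by rewrite mulrC -ler_pdivlMr // ge_min lexx orbT.
(* [A = T_1 a] is the least point from which the digit 1 lands at or above [a]. *)
pose A := rho * a + (1 - rho).
have A0 : 0 < A by rewrite /A addr_gt0 ?mulr_gt0 // subr_gt0.
have bonus y : a <= y <= m%:R -> A <= y <= m%:R ->
    gains rho f a m%:R y 1 (K * w 0).
  move=> _ /andP[Ay ym].
  (* Subtracting [1 - rho] beforehand makes the digit found, [j.+1], positive. *)
  have [||| j jm yj] := @exists_digit _ m.-1 (rho * a) (rho * m%:R) (1 - rho)
    (y - (1 - rho)).
  - lra.
  - by move: Ay; rewrite /A; lra.
  - have -> : m.-1%:R = m%:R - 1 :> R by rewrite -subn1 natrB.
    by lra.
  have j1m : (j.+1 <= m)%N by rewrite -(prednK m0).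
  apply: gains_le (Kw j.+1 _) _; first by rewrite j1m.
  apply: (gains_digit rho01 w_gt0 Hf) => //; rewrite preimage_digit_bounds // -natr1.
  by move: yj; lra.
have step y : a <= y <= m%:R -> gains rho f a m%:R y 1 (w 0).
  move=> yI; have [Ay|yA] := lerP A y.
    apply: (@gains_le _ _ _ _ _ _ _ (K * w 0)); first by rewrite ler_peMl // ltW.
    by apply: bonus => //; rewrite Ay; case/andP: yI.
  apply: (gains_digit rho01 w_gt0 Hf) => //; rewrite preimage_digit_bounds // mulr0 subr0.
  case/andP: yI => ay _; apply/andP; split.
    by apply: le_trans ay; rewrite ler_piMl // ltW.
  by apply: le_trans (ltW yA) _; rewrite /A; lra.
have Ab : A <= rho * m%:R by rewrite /A; lra.
(* Expanded, this is [a <= A]; with the choice of [a] it gives [a <= rho * m]. *)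
have hint : 0 <= (1 - rho) * (1 - a) by rewrite mulr_ge0 // subr_ge0 // ltW.
have [n An] := climb_length a0 A0.
have base : forall x, a <= x <= m%:R -> forall k,
    (K * w 0 ^+ n.+1) ^+ k <= f x (m%:R * rho ^+ (n.+1 * k)).
  move=> x xI; apply: (gains_iter Hf _ (ltW a0) (lexx _) _ xI) => [y yI|].
    apply: (gains_climb rho01 w_gt0 Hf (ltW a0) _ Ab Ab step bonus yI) => //.
    - exact: le_trans ler01 (ltW K1).
    - by case/andP: yI.
    - by case/andP: yI => ay _; apply: le_trans ay.
  by rewrite mulr_ge0 ?exprn_ge0 ?(ltW w0) // (le_trans ler01) // ltW.
exists n.+1, K; split=> // x /= xI; case/andP: (xI) => x0 xm.
have [n' Hn'] := climb_length x0 a0.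
by apply: (reach_interval rho01 w_gt0 Hf a0 _ base (n := n')) => //; lra.
Qed.

Section Unbiased.
Context (a : R).
Hypotheses (a_gt0 : 0 < a) (a_le1 : a <= 1).
(** Implies [A <= rho * (m - A)] for the [A] below, so a climbing orbit cannot jump over
    [[A, m - A]]. *)
Hypothesis a_small : 2 * (rho * a) <= rho * m%:R - (1 - rho ^+ 2).

Let A := rho * a + (1 - rho).

Let rho_a_le : rho * (rho * a) <= rho * a.
Proof. by rewrite ler_piMl ?ltW // mulr_gt0. Qed.

Let rho2_le : rho ^+ 2 <= rho.
Proof. by rewrite expr2 ler_piMl ?ltW. Qed.

Let m_gt0 : (0 < m)%N.
Proof.
rewrite lt0n; apply: contraTneq a_small => m0.
have : 0 < rho * a by rewrite mulr_gt0.
by move: rho_lt1 rho2_le => /=; rewrite m0 mulr0 -ltNge; lra.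
Qed.

(** The window is [[T_1 a, T_(m-1) (m - a)]]. For [m = 1] it is the overlap of the two images and
    both digits serve; otherwise a digit strictly between 0 and [m] does. *)
Lemma unbiased_window (w : nat -> R) f (y : R) :
  (forall j, (j <= m)%N -> 0 < w j) -> cantor_profile m rho w f ->
  w m = w 0 -> (forall j, (0 < j < m)%N -> 2 * w 0 <= w j) ->
  A <= y <= m%:R - A -> gains rho f a (m%:R - a) y 1 (2 * w 0).
Proof.
move=> w_gt0 Hf wm w2 /andP[]; rewrite /A => Ay ym; have rho1 := ltW rho_lt1; have a1 := a_le1.
have am := a_small; have rho2 := rho2_le.
have [m1|m2] := leqP m 1.
  have m_eq : m = 1%N by apply/eqP; rewrite eqn_leq m1 m_gt0.
  move: (ym) wm w_gt0 Hf; rewrite m_eq => ym1 wm w_gt0 Hf.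
  have -> : 2 * w 0 = w 0 + w 1 by rewrite wm mulr_natl.
  apply: (gains_two_digits rho01 w_gt0 Hf) => //; rewrite preimage_digit_bounds //; lra.
have [||| j jm yj] := @exists_digit _ m.-2 (rho * a) (rho * (m%:R - a)) (1 - rho)
    (y - (1 - rho)).
- lra.
- lra.
- have -> : m.-2%:R = m%:R - 2 :> R by rewrite -subn2 natrB.
  by lra.
have j1m : (0 < j.+1 < m)%N by move: m2 jm; case: (m) => [|[|]].
apply: gains_le (w2 _ j1m) _.
apply: (gains_digit rho01 w_gt0 Hf) => //; first by case/andP: j1m => _ /ltnW.
by rewrite preimage_digit_bounds // -natr1; move: yj; lra.
Qed.

(** Climbing starts from the left of the window or inside it; points beyond [m - A] are left to the
    reflection. *)
Lemma unbiased_climb (w : nat -> R) f n (x : R) :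
  (forall j, (j <= m)%N -> 0 < w j) -> cantor_profile m rho w f ->
  w m = w 0 -> (forall j, (0 < j < m)%N -> 2 * w 0 <= w j) ->
  A * rho ^+ n <= a -> a <= x <= m%:R - a -> x <= m%:R - A ->
  gains rho f a (m%:R - a) x n.+1 (2 * w 0 ^+ n.+1).
Proof.
move=> w_gt0 Hf wm w2 An; have rho1 := ltW rho_lt1; have a1 := a_le1.
have am := a_small; have rho2 := rho2_le; have rhoa := rho_a_le; have w0 : 0 < w 0 by apply: w_gt0.
have ra_le : rho * a <= a by rewrite ler_piMl // ltW.
have step (y : R) : a <= y <= m%:R - a -> gains rho f a (m%:R - a) y 1 (w 0).
  move=> /andP[ay ya].
  have [Ay|yA] := lerP A y; last first.
    apply: (gains_digit rho01 w_gt0 Hf) => //.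
    rewrite preimage_digit_bounds // mulr0 subr0.
    apply/andP; split; first by apply: le_trans ay; rewrite ler_piMl // ltW.
    by apply: le_trans (ltW yA) _; rewrite /A; lra.
  have [yA|Ay'] := lerP y (m%:R - A).
    apply: (@gains_le _ _ _ _ _ _ _ (2 * w 0)).
      by rewrite ler_peMl ?(ltW w0) // ler1n.
    by apply: unbiased_window Hf _ _ _ => //; rewrite Ay.
  (* Above [m - A] the digit [m] keeps the orbit inside, at the same rate by [wm]. *)
  rewrite -wm; apply: (gains_digit rho01 w_gt0 Hf) => //.
  by rewrite preimage_digit_bounds //; move: Ay'; rewrite /A; lra.
move=> xI xA; apply: (gains_climb rho01 w_gt0 Hf (t := m%:R - A) (A := A)) => //.
- exact: ltW.
- by rewrite /A; lra.
- by rewrite /A; lra.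
- by move=> y _ yA; apply: unbiased_window Hf _ _ _.
- by apply: le_trans An _; case/andP: xI.
Qed.

End Unbiased.

Lemma unbiased_growth (w : nat -> R) f :
  (forall j, (j <= m)%N -> 0 < w j) -> cantor_profile m rho w f ->
  w m = w 0 -> (forall j, (0 < j < m)%N -> 2 * w 0 <= w j) ->
  1 - rho ^+ 2 < rho * m%:R ->
  uniform_growth m rho (w 0) [set x | 0 < x < m%:R] f.
Proof.
move=> w_gt0 Hf wm w2 hm; have rho1 := ltW rho_lt1; have w0 : 0 < w 0 by apply: w_gt0.
have rho2_le : rho ^+ 2 <= rho by rewrite expr2 ler_piMl ?ltW.
have [a [a0 a1 am]] : exists a,
    [/\ 0 < a, a <= 1 & 2 * (rho * a) <= rho * m%:R - (1 - rho ^+ 2)].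
  exists (Num.min 1 ((rho * m%:R - (1 - rho ^+ 2)) / (2 * rho))); split.
  - by rewrite lt_min ltr01 divr_gt0 ?subr_gt0 // mulr_gt0.
  - by rewrite ge_min lexx.
  - by rewrite mulrA mulrC -ler_pdivlMr ?mulr_gt0 // ge_min lexx orbT.
have ra_le : rho * a <= rho by rewrite ler_piMr // ltW.
have A0 : 0 < rho * a + (1 - rho) by rewrite addr_gt0 ?mulr_gt0 // subr_gt0.
have [n An] := climb_length a0 A0.
have Hf' := reflect_profile rho01 Hf.
pose w' j := w (m - j)%N.
have w'_gt0 j : (j <= m)%N -> 0 < w' j by move=> _; rewrite w_gt0 // leq_subr.
have w'0 : w' 0 = w 0 by rewrite /w' subn0.
have w'm : w' m = w' 0 by rewrite w'0 /w' subnn.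
have w'2 j : (0 < j < m)%N -> 2 * w' 0 <= w' j.
  move=> /andP[j0 jm]; rewrite w'0 w2 // subn_gt0 jm ltn_subrL j0.
  by rewrite (leq_ltn_trans _ jm).
have gain x : a <= x <= m%:R - a ->
    gains rho f a (m%:R - a) x n.+1 (2 * w 0 ^+ n.+1).
  move=> xI; have [xA|Ax] := lerP x (m%:R - (rho * a + (1 - rho))).
    exact: unbiased_climb Hf _ _ _ _ _.
  move=> r h h0 hr; rewrite -w'0 -[x](subKr m%:R).
  have g := @unbiased_climb a a0 a1 am _ _ n (m%:R - x) w'_gt0 Hf' w'm w'2 An.
  have xl : m%:R - x <= m%:R - (rho * a + (1 - rho)).
    (* A point beyond [m - A] reflects to one below [m - A] because [A <= m - A]; multiplied by
       [rho], this follows from [(1 - rho)^2 >= 0]. *)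
    suff : 2 * (rho * a + (1 - rho)) <= m%:R by lra.
    have rra : rho * (rho * a) <= rho * a by rewrite ler_piMl ?mulr_ge0 // ltW.
    have sq := sqr_ge0 (1 - rho).
    by rewrite -(ler_pM2l rho_gt0); lra.
  apply: g => [||//|y yI]; [lra|exact: xl|].
  by apply: hr; lra.
have base x : a <= x <= m%:R - a -> forall k,
    (2 * w 0 ^+ n.+1) ^+ k <= f x (m%:R * rho ^+ (n.+1 * k)).
  move=> xI; apply: (gains_iter Hf gain (ltW a0) _ _ xI); first by lra.
  by rewrite mulr_ge0 // exprn_ge0 // ltW.
have base' x : a <= x <= m%:R - a -> forall k,
    (2 * w 0 ^+ n.+1) ^+ k <= f (m%:R - x) (m%:R * rho ^+ (n.+1 * k)).
  by move=> xI; apply: base; lra.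
have ab : a <= rho * (m%:R - a).
  have : 0 <= (1 - rho) * (1 - a) by rewrite mulr_ge0 // subr_ge0 // ltW.
  lra.
exists n.+1, 2; split=> //; first by rewrite ltr1n.
move=> x /= /andP[x0 xm]; have [xa|ax] := lerP x (m%:R - a).
  have [n' Hn'] := climb_length x0 a0.
  by apply: (reach_interval rho01 w_gt0 Hf a0 ab base (n := n')) => //; lra.
have x0' : 0 < m%:R - x by lra.
have [n' Hn'] := climb_length x0' a0.
rewrite -{1}[x](subKr m%:R).
apply: (reach_interval rho01 w'_gt0 Hf' a0 ab base' (n := n')) => //.
have ma0 : 0 < m%:R - a by rewrite -(pmulr_rgt0 _ rho_gt0) (lt_le_trans a0).
have : rho * (m%:R - a) <= m%:R - a by rewrite ler_piMl // ltW.
by lra.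
Qed.

End Growth.

(** * Limits of logarithmic ratios *)

Section LogRatio.
Context {R : realType}.
Implicit Types (g : R -> R) (d : R).

(** The error is a bounded numerator over [ln e], which tends to minus infinity. *)
Lemma log_ratio_cvg g d C e0 : 0 < e0 ->
  (forall e, 0 < e < e0 -> `|ln (g e) - d * ln e| <= C) ->
  ln (g e) / ln e @[e --> 0^'+] --> d.
Proof.
move=> e0_gt0 H; apply/cvgrPdist_le => eps eps0.
near=> e.
have e_gt0 : 0 < e by near: e; exact: nbhs_right_gt.
have ee0 : e < e0 by near: e; exact: nbhs_right_lt.
have lne : ln e <= - (`|C| / eps) - 1.
  by near: e; exact: cvgrNy_le (@lnNy R) _.
have C0 : 0 <= `|C| / eps by rewrite divr_ge0 // ltW.
have lne0 : ln e < 0 by lra.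
have -> : d - ln (g e) / ln e = - ((ln (g e) - d * ln e) / ln e).
  by field; rewrite lt_eqF.
rewrite normrN normrM normfV ler_pdivrMr ?normr_gt0 ?lt_eqF //.
apply: le_trans (H e _) _; first by rewrite e_gt0.
apply: le_trans (ler_norm C) _; rewrite mulrC -ler_pdivrMr // (ltr0_norm lne0).
lra.
Unshelve. all: by end_near.
Qed.

(** Since the limit is assumed to exist, bounds along one geometric sequence of scales suffice. *)
Lemma log_ratio_le g d rho c C M N : 0 < rho < 1 -> 0 < c -> 0 < C -> 0 < M ->
  (0 < N)%N -> (forall k, C * c ^+ k <= g (M * rho ^+ (N * k))) ->
  ln (g e) / ln e @[e --> 0^'+] --> d ->
  d <= ln c / (ln rho *+ N).
Proof.
move=> rho01 c0 C0 M0 N0 H Hd; have [rho0 rho1] := andP rho01.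
have lrho : ln rho < 0 by apply: ln_lt0.
have lN : ln rho *+ N < 0 by rewrite pmulrn_llt0.
rewrite leNgt; apply/negP => lt_d.
set d' := ln c / (ln rho *+ N) in lt_d; pose s := (d + d') / 2.
have d's : d' < s by rewrite /s; lra.
have sd : s < d by rewrite /s; lra.
have [del /= del0 Hdel] := cvgr_gt _ Hd _ sd.
have md0 : 0 < Num.min del 1 / M by rewrite divr_gt0 // lt_min del0 ltr01.
have [k0 Hk0] := expr_lt_eventually rho01 md0.
(* The two bounds on [ln (g e)], affine in [k], force [eta * k <= B]; [k] is taken large enough to
   violate this and to make [e] small. *)
pose eta := (s - d') * - (ln rho *+ N).
have eta0 : 0 < eta by rewrite mulr_gt0 ?subr_gt0 // oppr_gt0.
pose B := s * ln M - ln C.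
pose k := (k0 + Num.bound (`|B| / eta))%N.
pose e := M * rho ^+ (N * k).
have e0 : 0 < e by rewrite mulr_gt0 // exprn_gt0.
have : e < Num.min del 1.
  rewrite /e mulrC -ltr_pdivlMr // Hk0 //.
  by apply: leq_trans (leq_pmull k N0); rewrite leq_addr.
rewrite lt_min => /andP[edel e1].
have lne : ln e < 0 by rewrite ln_lt0 // e0.
have : s < ln (g e) / ln e.
  by apply: Hdel => //=; rewrite sub0r normrN gtr0_norm.
rewrite ltr_ndivlMr // => lt_g.
have Cc : 0 < C * c ^+ k by rewrite mulr_gt0 ?exprn_gt0.
have : ln (C * c ^+ k) <= ln (g e).
  by rewrite ler_ln ?posrE ?(lt_le_trans Cc) //; apply: H.
have lnE : ln e = ln M + (ln rho *+ N) * k%:R.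
  by rewrite /e lnM ?posrE ?exprn_gt0 // lnXn // mulrnA [in RHS]mulr_natr.
have lcE : ln c = d' * (ln rho *+ N) by rewrite /d' divfK // lt_eqF.
rewrite lnM ?posrE ?exprn_gt0 // lnXn // -mulr_natr lcE => le_g.
have kB : `|B| < eta * k%:R.
  rewrite mulrC -ltr_pdivrMr //.
  apply: lt_le_trans (archi_boundP _) _; first by rewrite divr_ge0 // ltW.
  by rewrite ler_nat leq_addl.
have Bk : eta * k%:R <= B.
  have -> : eta * k%:R = d' * (ln rho *+ N) * k%:R - s * ((ln rho *+ N) * k%:R).
    by rewrite /eta; ring.
  rewrite lerBlDr /B addrAC lerBrDl (le_trans le_g) // ltW //.
  by rewrite -mulrDr -lnE mulrC in lt_g *.
by have := lt_le_trans (le_lt_trans (ler_norm B) kB) Bk; rewrite ltxx.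
Qed.

End LogRatio.

(** * Local dimension at the endpoint 0 and the gap below it *)

Section EndpointDimension.
Context {R : realType} (m : nat) (rho : R) (w : nat -> R) (f : R -> R -> R).
Hypothesis rho01 : 0 < rho < 1.
Hypothesis w_gt0 : forall j, (j <= m)%N -> 0 < w j.
Hypothesis w0_le1 : w 0 <= 1.
Hypothesis m_gt0 : (0 < m)%N.
Hypothesis Hf : cantor_profile m rho w f.

Let rho_gt0 : 0 < rho. Proof. by case/andP: rho01. Qed.
Let rho_lt1 : rho < 1. Proof. by case/andP: rho01. Qed.
Let w0_gt0 : 0 < w 0. Proof. exact: w_gt0. Qed.

Lemma profile_le1 x r : 0 <= x <= m%:R -> f x r <= 1.
Proof.
move=> xm; rewrite -(profile_full Hf xm (r := Num.max r m%:R)).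
  by rewrite (profile_le Hf) // le_max lexx.
by rewrite le_max lexx orbT.
Qed.

Lemma profile0_ge k e : m%:R * rho ^+ k <= e -> w 0 ^+ k <= f 0 e.
Proof.
elim: k e => [|k IH] e; first by rewrite !expr0 mulr1 => me;
  rewrite (profile_full Hf) // lexx ler0n.
rewrite !exprS => me; have := profile_ge_digit w_gt0 Hf 0 e (leq0n m).
rewrite preimage_digit0 mul0r; apply: le_trans; rewrite ler_pM2l //.
by apply: IH; rewrite ler_pdivlMr // -mulrA [_ * rho]mulrC.
Qed.

(** For a digit [i > 0] the preimage ball lies left of 0 and is null, so only [w 0] contributes. The
    factor [rho] on the left avoids the exponent [k - 1]. *)
Lemma profile0_le k e : e * rho < (1 - rho) * rho ^+ k -> f 0 e <= w 0 ^+ k.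
Proof.
elim: k e => [|k IH] e; first by rewrite expr0 profile_le1 // lexx ler0n.
rewrite !exprSr mulrA ltr_pM2r // => e_lt.
rewrite (profile_split Hf) big_ord_recl /= mulr0 subr0 mul0r big1 ?addr0.
  by rewrite mulrC ler_pM2r // IH // divfK // gt_eqF.
move=> i _; rewrite (profile_null Hf) ?mulr0 //; left.
rewrite sub0r mulNr addrC -mulrBl pmulr_llt0 ?invr_gt0 // subr_lt0.
apply: lt_le_trans e_lt _; rewrite ler_wpM2l ?subr_ge0 ?(ltW rho_lt1) //.
rewrite (@le_trans _ _ 1) ?exprn_ile1 ?(ltW rho_gt0) ?(ltW rho_lt1) //.
by rewrite /bump /= ler1n.
Qed.

(** [f 0 e] lies between powers of [w 0] whose exponents differ from [ln e / ln rho] by bounded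
    amounts. *)
Lemma endpoint_dimension : ln (f 0 e) / ln e @[e --> 0^'+] --> ln (w 0) / ln rho.
Proof.
have l_lt0 : ln rho < 0 by apply: ln_lt0.
have lw : ln (w 0) <= 0 by apply: ln_le0.
have rho0 := rho_gt0; have rho1 : 0 < 1 - rho by rewrite subr_gt0.
set l := ln rho in l_lt0 *; set lam := ln (w 0) in lw *; pose d := lam / l.
have d0 : 0 <= d by rewrite /d mulr_le0 // invr_le0 ltW.
have dl : d * l = lam by rewrite divfK // lt_eqF.
have lnP k : ln (rho ^+ k) = l * k%:R by rewrite lnXn // mulr_natr.
have lnW k : ln (w 0 ^+ k) = lam * k%:R by rewrite lnXn // mulr_natr.
(* With this [q] the hypothesis of [profile0_le] reads [ln e - q < l * k]. *)
pose q := ln (1 - rho) - l.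
apply: (@log_ratio_cvg _ _ d
  (`|d * ln m%:R| - lam + (`|d * q| - 2 * lam)) (1 - rho)) => // e /andP[e0 e1].
have m0 : 0 < m%:R :> R by rewrite ltr0n.
have m1 : 1 <= m%:R :> R by rewrite ler1n.

have lower : d * ln e - d * ln m%:R + lam <= ln (f 0 e) /\ 0 < f 0 e.
  have x0 : 0 <= (ln e - ln m%:R) / l.
    rewrite mulr_le0 ?invr_le0 ?(ltW l_lt0) // subr_le0 ler_ln ?posrE //; lra.
  have /andP[kx xk] := truncn_itv x0.
  set k := Num.truncn _ in kx xk.
  have wf : w 0 ^+ k.+1 <= f 0 e.
    apply: profile0_ge; rewrite -ler_ln ?posrE ?mulr_gt0 ?exprn_gt0 //.
    rewrite lnM ?posrE ?exprn_gt0 // lnP.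
    by move: (ltW xk); rewrite ler_ndivrMr //; lra.
  have f0 : 0 < f 0 e by apply: lt_le_trans wf; rewrite exprn_gt0.
  split=> //; move: wf; rewrite -ler_ln ?posrE ?exprn_gt0 // lnW; apply: le_trans.
  have : lam * ((ln e - ln m%:R) / l) <= lam * k%:R by rewrite ler_wnM2l.
  have -> : lam * ((ln e - ln m%:R) / l) = d * ln e - d * ln m%:R.
    by rewrite /d; field; rewrite lt_eqF.
  by rewrite -natr1; lra.
have [low f0] := lower.
have upper : ln (f 0 e) <= d * ln e - d * q - 2 * lam.
  (* Subtracting 1 before truncating gives the strict [k < (ln e - q) / l]. *)
  have x0 : 0 <= (ln e - q) / l - 1.
    rewrite subr_ge0 ler_ndivlMr // mul1r /q lerBlDr subrKC ler_ln ?posrE //.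
    exact: ltW.
  have /andP[kx xk] := truncn_itv x0.
  set k := Num.truncn _ in kx xk.
  have : f 0 e <= w 0 ^+ k.
    apply: profile0_le; rewrite -ltr_ln ?posrE ?mulr_gt0 ?exprn_gt0 //.
    rewrite !lnM ?posrE ?exprn_gt0 // lnP -/l.
    have : k%:R < (ln e - q) / l by lra.
    by rewrite ltr_ndivlMr // /q; lra.
  rewrite -ler_ln ?posrE ?exprn_gt0 // lnW => /le_trans; apply.
  have : lam * k%:R <= lam * ((ln e - q) / l - 2).
    by rewrite ler_wnM2l //; move: xk; rewrite -natr1; lra.
  have -> : lam * ((ln e - q) / l - 2) = d * ln e - d * q - 2 * lam.
    by rewrite /d; field; rewrite lt_eqF.
  by [].
have := normr_ge0 (d * ln m%:R); have := normr_ge0 (d * q).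
have := ler_norm (d * ln m%:R); have := ler_norm (- (d * q)).
by rewrite normrN ler_norml -/d; move=> *; apply/andP; split; lra.
Qed.

Lemma endpoint_charged e : 0 < e -> 0 < f 0 e.
Proof.
move=> e0; have m0 : 0 < m%:R :> R by rewrite ltr0n.
have [k Hk] := expr_lt_eventually rho01 (divr_gt0 e0 m0).
apply: lt_le_trans (_ : w 0 ^+ k <= _); first by rewrite exprn_gt0.
by apply: profile0_ge; rewrite mulrC -ler_pdivlMr // ltW // Hk.
Qed.

(** A factor [K] per [N] digits lowers the bound on the dimension by [ln K / (N * |ln rho|)]. *)
Lemma growth_dimension_gap (D : set R) : uniform_growth m rho (w 0) D f ->
  exists2 c, 0 < c & forall x d, D x ->
    ln (f x e) / ln e @[e --> 0^'+] --> d -> d <= ln (w 0) / ln rho - c.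
Proof.
move=> [N [K [N0 K1 H]]]; have l_lt0 : ln rho < 0 by apply: ln_lt0.
have lN : ln rho *+ N < 0 by rewrite pmulrn_llt0.
have K0 : 0 < K by apply: lt_trans K1.
exists (- (ln K / (ln rho *+ N))) => [|x d Dx Hd].
  by rewrite oppr_gt0 pmulr_rlt0 ?ln_gt0 // invr_lt0.
have [C C0 HC] := H x Dx.
have m0 : 0 < m%:R :> R by rewrite ltr0n.
have KN : 0 < K * w 0 ^+ N by rewrite mulr_gt0 ?exprn_gt0.
have := log_ratio_le rho01 KN C0 m0 N0 HC Hd.
rewrite lnM ?posrE ?exprn_gt0 // lnXn // opprK => /le_trans; apply.
rewrite mulrDl addrC lerD2r -[ln (w 0) *+ N]mulr_natr -[ln rho *+ N]mulr_natr.
rewrite -mulf_div divff ?mulr1 // pnatr_eq0; by case: (N) N0.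
Qed.

End EndpointDimension.

(** Isolation of the largest value, in a form stable under reflection. Other points may attain [d0],
    since both endpoints can share it. *)
Definition dimension_gap (R : realType) (m : nat) (f : R -> R -> R) : Prop :=
  exists x0 d0 c, [/\ 0 <= x0 <= m%:R, forall e, 0 < e -> 0 < f x0 e,
    ln (f x0 e) / ln e @[e --> 0^'+] --> d0, 0 < c &
    forall x d, 0 <= x <= m%:R -> ln (f x e) / ln e @[e --> 0^'+] --> d ->
      d = d0 \/ d <= d0 - c].

(** * The gap for binomial weights *)

Section DimensionGap.
Context {R : realType} (m : nat) (rho : R).
Hypothesis rho01 : 0 < rho < 1.
Hypothesis m_gt0 : (0 < m)%N.
Implicit Types (w : nat -> R) (f : R -> R -> R).

Lemma local_dimension_unique (g : R -> R) (d d' : R) :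
  g e @[e --> 0^'+] --> d -> g e @[e --> 0^'+] --> d' -> d = d'.
Proof. exact: cvg_unique. Qed.

Lemma dimension_gap_reflect f :
  dimension_gap m (fun x => f (m%:R - x)) -> dimension_gap m f.
Proof.
move=> [x0 [d0 [c [x0m H0 H1 c0 H2]]]]; exists (m%:R - x0), d0, c.
split=> //; first by lra.
move=> x d xm Hd; apply: (H2 (m%:R - x)); first by lra.
by rewrite subKr.
Qed.

(** For [j > 0] the ratio of [w j] to [w 0] is ['C(m, j) * ((1 - p) / p) ^+ j], at least
    [(1 - p) / p]. Growth then holds at every point but 0. *)
Lemma biased_gap w f p : 0 < p -> p < 1 - p ->
  (forall j, (j <= m)%N -> w j = 'C(m, j)%:R * p ^+ (m - j) * (1 - p) ^+ j) ->
  cantor_profile m rho w f -> 1 - rho < rho * m%:R -> dimension_gap m f.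
Proof.
move=> p0 pq Hw Hf hm; have q0 : 0 < 1 - p by apply: lt_trans pq.
have w_gt0 j : (j <= m)%N -> 0 < w j.
  by move=> jm; rewrite Hw // !mulr_gt0 ?exprn_gt0 // ltr0n bin_gt0.
have w0E : w 0 = p ^+ m by rewrite Hw // bin0 subn0 expr0 mulr1 mul1r.
have w0_le1 : w 0 <= 1 by rewrite w0E exprn_ile1 //; lra.
have K1 : 1 < (1 - p) / p by rewrite ltr_pdivlMr // mul1r.
have Kw j : (0 < j <= m)%N -> (1 - p) / p * w 0 <= w j.
  case: j => // j jm; rewrite w0E Hw // mulrAC ler_pdivrMr //.
  rewrite -[in leLHS](subnK jm) exprD exprS [in leRHS]exprS.
  have pj : p ^+ j <= (1 - p) ^+ j by apply: lerXn2r; rewrite ?nnegrE ltW.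
  have C1 : 1 <= 'C(m, j.+1)%:R :> R by rewrite ler1n bin_gt0.
  have P0 : 0 < p ^+ (m - j.+1) by rewrite exprn_gt0.
  have -> : (1 - p) * (p ^+ (m - j.+1) * (p * p ^+ j)) =
    p ^+ (m - j.+1) * ((1 - p) * p) * p ^+ j by ring.
  have -> : 'C(m, j.+1)%:R * p ^+ (m - j.+1) * ((1 - p) * (1 - p) ^+ j) * p =
    'C(m, j.+1)%:R * (p ^+ (m - j.+1) * ((1 - p) * p) * (1 - p) ^+ j) by ring.
  have Q0 : 0 <= p ^+ (m - j.+1) * ((1 - p) * p) by rewrite ltW // !mulr_gt0.
  apply: le_trans (ler_wpM2l Q0 pj) _; rewrite ler_peMl //.
  by rewrite mulr_ge0 // exprn_ge0 // ltW.
have G := biased_growth rho01 w_gt0 Hf K1 Kw hm.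
have [c c0 Hc] := growth_dimension_gap rho01 w_gt0 m_gt0 G.
have E := endpoint_dimension rho01 w_gt0 w0_le1 m_gt0 Hf.
exists 0, (ln (w 0) / ln rho), c; split=> //; first by rewrite lexx ler0n.
  exact: (endpoint_charged rho01 w_gt0 m_gt0 Hf).
move=> x d /andP[]; rewrite le_eqVlt => /predU1P[<- _ Hd|x0 xm Hd].
  by left; exact: local_dimension_unique Hd E.
by right; apply: Hc Hd; rewrite /= x0.
Qed.

(** Inner binomial coefficients are at least 2; the two endpoints, excluded from the growth, share
    one dimension by reflection. *)
Lemma unbiased_gap w f p : 0 < p < 1 -> p = 1 - p ->
  (forall j, (j <= m)%N -> w j = 'C(m, j)%:R * p ^+ (m - j) * (1 - p) ^+ j) ->
  cantor_profile m rho w f -> 1 - rho ^+ 2 < rho * m%:R -> dimension_gap m f.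
Proof.
move=> /andP[p0 p1] pq Hw' Hf hm.
have Hw j : (j <= m)%N -> w j = 'C(m, j)%:R * p ^+ m.
  by move=> jm; rewrite Hw' // -pq -mulrA -exprD subnK.
have w_gt0 j : (j <= m)%N -> 0 < w j.
  by move=> jm; rewrite Hw // mulr_gt0 ?exprn_gt0 // ltr0n bin_gt0.
have w0E : w 0 = p ^+ m by rewrite Hw // bin0 mul1r.
have wmE : w m = w 0 by rewrite w0E Hw // binn mul1r.
have w0_le1 : w 0 <= 1 by rewrite w0E exprn_ile1 // ltW.
have w2 j : (0 < j < m)%N -> 2 * w 0 <= w j.
  case/andP=> j0 jm; rewrite w0E Hw ?(ltnW jm) // ler_pM2r ?exprn_gt0 // ler_nat.
  case: (m) j j0 jm => // n [//|j] _ jn.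
  by rewrite binS -[2%N]/(1 + 1)%N leq_add // bin_gt0 // ltnW.
have G := unbiased_growth rho01 w_gt0 Hf wmE w2 hm.
have [c c0 Hc] := growth_dimension_gap rho01 w_gt0 m_gt0 G.
have E := endpoint_dimension rho01 w_gt0 w0_le1 m_gt0 Hf.
have Hf' := reflect_profile rho01 Hf.
have w'_gt0 j : (j <= m)%N -> 0 < w (m - j)%N by rewrite w_gt0 // leq_subr.
have w'0_le1 : w (m - 0)%N <= 1 by rewrite subn0 wmE.
have := endpoint_dimension rho01 w'_gt0 w'0_le1 m_gt0 Hf'.
rewrite subn0 wmE subr0 => E'.
exists 0, (ln (w 0) / ln rho), c; split=> //; first by rewrite lexx ler0n.
  exact: (endpoint_charged rho01 w_gt0 m_gt0 Hf).
move=> x d /andP[]; rewrite le_eqVlt => /predU1P[<- _ Hd|x0].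
  by left; exact: local_dimension_unique Hd E.
rewrite le_eqVlt => /predU1P[-> Hd|xm Hd].
  by left; exact: local_dimension_unique Hd E'.
by right; apply: Hc Hd; rewrite /= x0.
Qed.

Lemma binomial_gap w f p : 0 < p < 1 ->
  (forall j, (j <= m)%N -> w j = 'C(m, j)%:R * p ^+ (m - j) * (1 - p) ^+ j) ->
  cantor_profile m rho w f ->
  (p <> 1 - p /\ rho > 1 / (m%:R + 1)) \/
    ((p = 1 - p /\ p = 1 / 2) /\ rho > (Num.sqrt (m%:R ^+ 2 + 4) - m%:R) / 2) ->
  dimension_gap m f.
Proof.
move=> p01 Hw Hf; have /andP[p0 p1] := p01.
have /andP[rho0 rho1] := rho01.
case=> [[pq hm]|[[pq _] hm]].
  have {}hm : 1 - rho < rho * m%:R.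
    by move: hm; rewrite ltr_pdivrMr ?mulrDr ?mulr1; [lra|rewrite ltr_wpDl].
  have [pltq|qltp|//] := ltgtP p (1 - p); first exact: biased_gap Hw Hf hm.
  (* Reflection exchanges [p] and [1 - p]. *)
  apply: dimension_gap_reflect.
  apply: (biased_gap (p := 1 - p) _ _ _ (reflect_profile rho01 Hf) hm).
  - by rewrite subr_gt0.
  - by rewrite subKr.
  - by move=> j jm; rewrite Hw ?leq_subr // bin_sub // subKn // subKr mulrAC.
apply: unbiased_gap p01 pq Hw Hf _.
have S0 : 0 <= m%:R ^+ 2 + 4 :> R by rewrite addr_ge0 ?sqr_ge0.
have mR : 0 <= m%:R :> R by rewrite ler0n.
have : Num.sqrt (m%:R ^+ 2 + 4) < 2 * rho + m%:R.
  by move: hm; rewrite ltr_pdivrMr //; lra.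
(* Squaring yields [1 - rho ^+ 2 < rho * m]. *)
rewrite -(@ltr_pXn2r R 2) ?nnegrE ?sqrtr_ge0 //; last by lra.
by rewrite sqr_sqrtr //; lra.
Qed.

End DimensionGap.

(** * Self-similarity of convolution powers *)

Section SelfSimilarity.
Context {R : realType}.
Local Notation RB := (measurableTypeR R).
Implicit Types (mu nu : probability RB R) (rho p : R) (A : set RB).

Definition digit_map rho (j : nat) (x : RB) : RB := rho * x + (1 - rho) * j%:R.

Let measurable_digit_map rho j : measurable_fun [set: RB] (digit_map rho j).
Proof.
apply: measurable_funD => //; apply: measurable_funM => //.
Qed.

HB.instance Definition _ rho j :=
  isMeasurableFun.Build _ _ _ _ (digit_map rho j) (measurable_digit_map rho j).

Definition binomial_weight (n : nat) p (j : nat) : R :=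
  'C(n, j)%:R * p ^+ (n - j) * (1 - p) ^+ j.

(** Here [n] counts the maps, so an [m]-fold convolution has [n = m.+1]. *)
Definition self_similar rho (n : nat) (u : nat -> R) nu : Prop :=
  forall A, measurable A ->
    nu A = (\sum_(j < n) (u j)%:E * nu (digit_map rho j @^-1` A))%E.

(** The measure is a finite sum of scaled image measures; each term is a change of variables. *)
Lemma self_similar_integral rho n u nu (h : RB -> \bar R) :
  (forall j, 0 <= u j) -> self_similar rho n u nu ->
  measurable_fun [set: RB] h -> (forall x, 0 <= h x)%E ->
  (\int[nu]_x h x =
   \sum_(j < n) (u j)%:E * \int[nu]_x h (digit_map rho j x))%E.
Proof.
move=> u0 Hnu mh h0.
pose m_ j : {measure set RB -> \bar R} :=
  mscale (NngNum (u0 j)) (distribution nu (digit_map rho j)).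
rewrite (@eq_measure_integral _ _ _ _ (msum m_ n)); last by move=> A mA _; exact: Hnu.
rewrite ge0_integral_measure_sum //; apply: eq_bigr => j _.
rewrite ge0_integral_mscale //; congr (_ * _)%E.
by rewrite ge0_integral_distribution.
Qed.

Lemma measurable_preimage_digit_map rho j A :
  measurable A -> measurable (digit_map rho j @^-1` A).
Proof. exact: measurable_funPTI. Qed.

Lemma measurable_preimage_add_pair A :
  measurable A -> measurable (@Defs.add_pair R @^-1` A).
Proof. exact: measurable_funPTI. Qed.

Lemma convolutionE nu mu A :
  convolution nu mu A = (\int[nu]_x mu (xsection (@Defs.add_pair R @^-1` A) x))%E.
Proof. by []. Qed.

(** Rests on [T_j x + S0 y = T_j (x + y)] and [T_j x + S1 y = T_(j+1) (x + y)]: [nu] is split in the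
    outer integral, [mu] on each section. *)
Lemma convolution_split rho p n u nu mu A : 0 <= p <= 1 -> (forall j, 0 <= u j) ->
  self_similar rho n u nu -> is_bernoulli_convolution rho p (1 - p) mu ->
  measurable A ->
  (convolution nu mu A = \sum_(j < n) (u j)%:E *
    (p%:E * convolution nu mu (digit_map rho j @^-1` A) +
     (1 - p)%:E * convolution nu mu (digit_map rho j.+1 @^-1` A)))%E.
Proof.
move=> /andP[p0 p1] u0 Hnu [_ Hmu] mA.
have mT j : measurable (digit_map rho j @^-1` A).
  exact: measurable_preimage_digit_map.
have q0 : (0 <= (1 - p)%:E)%E by rewrite lee_fin subr_ge0.
have msec B : measurable B ->
    measurable_fun [set: RB] (fun x => mu (xsection (@Defs.add_pair R @^-1` B) x)).
  by move=> mB; apply: measurable_fun_xsection; exact: measurable_preimage_add_pair.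
rewrite convolutionE (self_similar_integral u0 Hnu) //; last exact: msec.
apply: eq_bigr => j _; congr (_ * _)%E.
rewrite !convolutionE -!ge0_integralZl ?lee_fin //; try by apply: msec.
rewrite -ge0_integralD //; last 4 first.
- by move=> x _; rewrite mule_ge0.
- by apply: measurable_funeM; apply: msec.
- by move=> x _; rewrite mule_ge0.
- by apply: measurable_funeM; apply: msec.
apply: eq_integral => x _; rewrite Hmu; last first.
  by apply: measurable_xsection; exact: measurable_preimage_add_pair.
congr (_ * mu _ + _ * mu _)%E; apply/seteqP; split => y;
  rewrite /xsection /= !inE /Defs.add_pair /digit_map /S0 /S1 /=;
  by move/(@eq_ind _ _ A); apply; rewrite -?natr1; ring.
Qed.

(** Pascal's rule, after collecting the coefficient of each [a j]. *)
Lemma binomial_weight_sum (n : nat) (p : R) (a : nat -> R) :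
  \sum_(j < n.+1) binomial_weight n p j * (p * a j + (1 - p) * a j.+1) =
  \sum_(j < n.+2) binomial_weight n.+1 p j * a j.
Proof.
(* The terms with factor [p]; at [j = n.+1] the binomial vanishes, so the range can be extended. *)
pose b j := 'C(n, j)%:R * p ^+ (n.+1 - j) * (1 - p) ^+ j * a j.
transitivity (\sum_(j < n.+2) b j +
    \sum_(j < n.+1) binomial_weight n p j * ((1 - p) * a j.+1)).
  rewrite [X in _ = X + _]big_ord_recr /= {2}/b bin_small // !mul0r addr0 -big_split /=.
  apply: eq_bigr => j _; rewrite /binomial_weight mulrDr; congr (_ + _).
  have jn : (j <= n)%N by rewrite -ltnS.
  by rewrite /b (subSn jn) exprS; ring.
rewrite big_ord_recl [in RHS]big_ord_recl /= -addrA -big_split /=; congr (_ + _).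
  by rewrite /b /binomial_weight !bin0.
apply: eq_bigr => j _; rewrite /b /binomial_weight /bump /= add1n subSS binS natrD.
by rewrite exprS; ring.
Qed.

Lemma convolution_power_self_similar rho p mu n : 0 < p < 1 ->
  is_bernoulli_convolution rho p (1 - p) mu ->
  self_similar rho n.+2 (binomial_weight n.+1 p) (convolution_power mu n.+1).
Proof.
move=> /andP[p0 p1] Hmu.
have w0 k j : 0 <= binomial_weight k p j.
  by rewrite /binomial_weight !mulr_ge0 ?exprn_ge0 ?subr_ge0 // ltW.
elim: n => [|n IH] A mA.
  have w10 : binomial_weight 1 p 0 = p.
    by rewrite /binomial_weight bin0 subn0 expr0 expr1 mul1r mulr1.
  have w11 : binomial_weight 1 p 1 = 1 - p.
    by rewrite /binomial_weight bin1 subnn expr0 expr1 mulr1 mul1r.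
  rewrite /= (proj2 Hmu A mA) !big_ord_recl big_ord0 adde0 /bump /= w10 w11.
  congr (_ * mu _ + _ * mu _)%E; apply/seteqP; split => y;
    rewrite /digit_map /S0 /S1 /bump /=;
    by move/(@eq_ind _ _ A); apply; ring.
have p01 : 0 <= p <= 1 by rewrite !ltW.
change (convolution_power mu n.+2) with (convolution (convolution_power mu n.+1) mu).
set nu := convolution _ _.
rewrite (convolution_split p01 (w0 _) IH Hmu mA) -/nu.
pose a j := fine (nu (digit_map rho j @^-1` A)).
have aE j : nu (digit_map rho j @^-1` A) = (a j)%:E.
  by rewrite fineK // fin_num_measure //; exact: measurable_preimage_digit_map.
transitivity (\sum_(j < n.+2)
    (binomial_weight n.+1 p j * (p * a j + (1 - p) * a j.+1))%:E)%E.
  by apply: eq_bigr => j _; rewrite !aE.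
rewrite sumEFin binomial_weight_sum -sumEFin.
by apply: eq_bigr => j _; rewrite aE.
Qed.

(** Addition maps the full-mass rectangle [[0, n + 1] x [0, 1]] into [[0, n + 2]]. *)
Lemma convolution_power_full mu n : mu `[0, 1]%classic = 1%E ->
  convolution_power mu n.+1 `[0, n.+1%:R]%classic = 1%E.
Proof.
move=> Hmu; elim: n => // n IH.
change (convolution_power mu n.+2) with (convolution (convolution_power mu n.+1) mu).
set nu := convolution_power mu n.+1 in IH *.
apply/eqP; rewrite eq_le probability_le1 //=.
rewrite -[leLHS](mule1 1%E) -{1}IH -Hmu -product_measure1E //.
apply: le_measure; rewrite ?inE.
- exact: measurableX.
- exact: measurable_preimage_add_pair.
move=> [x y] /= []; rewrite /Defs.add_pair /= !in_itv /=.
by move=> /andP[x0 xn] /andP[y0 y1]; rewrite addr_ge0 //= -natr1 lerD.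
Qed.

(** * Ball masses and support *)

Definition ball_mass nu (x r : R) : R := fine (nu `[x - r, x + r]%classic).

Lemma ball_mass_profile rho m u nu : 0 < rho < 1 ->
  nu `[0, m%:R]%classic = 1%E -> self_similar rho m.+1 u nu ->
  cantor_profile m rho u (ball_mass nu).
Proof.
move=> /andP[rho0 rho1] Hm Hnu.
have fin B : measurable B -> nu B \is a fin_num by exact: fin_num_measure.
split=> [x r s rs|x r /andP[x0 xm] mr|x r xr|x r|x r].
- apply: fine_le; rewrite ?fin // le_measure ?inE // => z /=.
  by rewrite !in_itv /= => /andP[z1 z2]; lra.
- have : nu `[x - r, x + r]%classic = 1%E.
    apply/eqP; rewrite eq_le probability_le1 //= -Hm le_measure ?inE // => z /=.
    by rewrite !in_itv /= => /andP[z1 z2]; lra.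
  by rewrite /ball_mass => ->.
- have : nu (~` `[0, m%:R]%classic) = 0%E.
    by rewrite probability_setC // Hm subee.
  rewrite /ball_mass => H0; suff -> : nu `[x - r, x + r]%classic = 0%E by [].
  apply: (subset_measure0 _ _ _ H0) => //; first exact: measurableC.
  by move=> z /=; rewrite !in_itv /= => /andP[z1 z2] /andP[z3 z4]; lra.
- exact: fine_ge0.
rewrite {1}/ball_mass Hnu // -sum_fine => [|j _]; last first.
  by rewrite fin_numM // fin //; exact: measurable_preimage_digit_map.
apply: eq_bigr => j _; rewrite /ball_mass fineM ?fin //; last first.
  exact: measurable_preimage_digit_map.
(* The preimage of a ball under [digit_map rho j] is the ball of radius [r / rho] about the preimage
   of its centre. *)
congr (_ * fine (nu _)); apply/seteqP; split => z;
  rewrite /digit_map /= !in_itv /= -mulrBl -mulrDl ler_pdivrMr // ler_pdivlMr //;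
  by rewrite [z * _]mulrC => /andP[z1 z2]; lra.
Qed.

Lemma msupport_of_ball_mass nu x :
  (forall e, 0 < e -> 0 < ball_mass nu x e) -> msupport nu x.
Proof.
move=> H U oU Ux; have [e /= e0 He] := oU x Ux.
have e2 : 0 < e / 2 by rewrite divr_gt0.
have mU : measurable (U : set RB) by exact: open_measurable.
pose I : set RB := `[x - e / 2, x + e / 2]%classic.
have sub : I `<=` U.
  move=> z; rewrite /I /= in_itv /= => z12; apply: He => /=.
  by rewrite ltr_norml; lra.
have lt0 : (0 < nu I)%E.
  rewrite lt0e measure_ge0 andbT; apply: contraTneq (H _ e2) => mu0.
  by rewrite /ball_mass -/I mu0 ltxx.
apply: lt_le_trans lt0 _; apply: le_measure => //; rewrite inE //.
exact: measurable_itv.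
Qed.

Lemma msupport_bounds nu (a b x : R) : nu `[a, b]%classic = 1%E ->
  msupport nu x -> a <= x <= b.
Proof.
move=> Hab Hx; apply: contraT => xab.
have : (0 < nu (~` `[a, b]%classic))%E.
  apply: Hx => /=; first by apply: closed_openC; exact: interval_closed.
  by rewrite in_itv /=; apply/negP.
by rewrite probability_setC // Hab subee // ltxx.
Qed.

End SelfSimilarity.

Theorem mainTheorem3 (R : realType) (m : nat) (rho p : R)
    (mu : probability (measurableTypeR R) R)
    (hm : (1 <= m)%N)
    (hrho : 0 < rho < 1)
    (hp : 0 < p < 1)
    (hmu : is_bernoulli_convolution rho p (1 - p) mu)
    (hcases : (p <> 1 - p /\ rho > 1 / (m%:R + 1)) \/
              ((p = 1 - p /\ p = 1 / 2) /\
               rho > (Num.sqrt (m%:R ^+ 2 + 4) - m%:R) / 2)) :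
  exists d : R, isolated (local_dimensions (convolution_power mu m)) d.
Proof.
case: m hm hcases => // n _ hcases.
set nu := convolution_power mu n.+1.
have full : nu `[0, n.+1%:R]%classic = 1%E by apply: convolution_power_full; case: hmu.
have Hf := ball_mass_profile hrho full (convolution_power_self_similar n hp hmu).
have [|x0 [d0 [c [x0m pos Hx0 c0 gap]]]] := binomial_gap hrho (ltn0Sn n) hp _ Hf hcases.
  by [].
have d0_in : local_dimensions nu d0 by exists x0; first exact: msupport_of_ball_mass.
exists d0; split; first exact/mem_set.
(* This ball is open, so it misses every value at most [d0 - c]. *)
exists (ball d0 c); first exact: nbhsx_ballx.
apply/seteqP; split=> [d [/= dc [x Hx Hd]]|d ->]; last first.
  by split=> //; exact: ballxx.
have [//|dd] := gap x d (msupport_bounds full Hx) Hd.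
by move: dc; rewrite /ball /= ltr_norml => /andP[_]; lra.
Qed.
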